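(* For any $m,n,p\in\mathbb{N}$ with $n\ge m$, $$\sum_{1\le N_1<\cdots<N_m\le n}N_m^{\,p}\cdots N_1^{\,p}=(-1)^m\sum_{\substack{(y_1,\ldots,y_m)\\ \sum i y_i=m}}\prod_{i=1}^{m}\frac{(-1)^{y_i}}{y_i!\,i^{y_i}}\left(\sum_{N=1}^{n}N^{ip}\right)^{y_i}=(-1)^m\sum_{\substack{(y_1,\ldots,y_m)\\ \sum i y_i=m}}\prod_{i=1}^{m}\frac{(-1)^{y_i}}{y_i!\,i^{y_i}}\left(\frac{n^{ip+1}}{ip+1}\sum_{j=0}^{ip}(-1)^j\binom{ip+1}{j}\frac{B_j}{n^j}\right)^{y_i},$$ where the sums over $(y_1,\ldots,y_m)$ run over all partitions of $m$ and $B_j$ are the Bernoulli numbers of the first kind.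
   Context: $\mathbb{N}=\{0,1,2,\ldots\}$. A partition of $m$ is represented by the tuple $(y_1,\ldots,y_m)$ of non-negative integers with $\sum_{i=1}^m i\,y_i=m$. For $m=0$ there is exactly one partition, the empty one. Empty products equal $1$, and a multiple sum of order $m=0$ equals $1$. The Bernoulli numbers of the first kind are given by $\frac{t}{e^t-1}=\sum_{j\ge0}B_j\frac{t^j}{j!}$, so $B_1=-\tfrac12$. *)

(* Defs.v *)
From mathcomp Require Import all_boot all_order all_algebra.

Set Implicit Arguments.
Unset Strict Implicit.
Unset Printing Implicit Defensive.

Import Order.TTheory GRing.Theory Num.Theory.
Local Open Scope ring_scope.

(* A formal power series over the rationals is its sequence of coefficients. *)
Definition fps := nat -> rat.

Definition fps_mul (a b : fps) : fps :=
  fun n => \sum_(k < n.+1) a k * b (n - k)%N.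

Definition fps_X : fps := fun n => (n == 1%N)%:R.

(* exp(t) - 1 *)
Definition fps_expm1 : fps := fun n => if n is 0 then 0 else (n`!)%:R^-1.

Definition fps_egf (B : nat -> rat) : fps := fun j => B j / (j`!)%:R.

(* t / (exp(t) - 1) = \sum_j B_j t^j / j!, with the denominator cleared because
   exp(t) - 1 has zero constant term; \Q[[t]] is a domain, so this determines
   B (is_bernoulli_uniq). *)
Definition is_bernoulli (B : nat -> rat) : Prop :=
  fps_mul (fps_egf B) fps_expm1 =1 fps_X.

Lemma is_bernoulliE B : is_bernoulli B <->
  forall n, \sum_(k < n.+1) fps_egf B k / ((n - k).+1`!)%:R = (n == 0%N)%:R.
Proof.
have E n : fps_mul (fps_egf B) fps_expm1 n.+1 =
  \sum_(k < n.+1) fps_egf B k / ((n - k).+1`!)%:R.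
  rewrite /fps_mul big_ord_recr /= subnn mulr0 addr0.
  by apply: eq_bigr => k _; rewrite subSn // -ltnS.
split=> [HB n | HB [|n]]; first by rewrite -E HB.
  by rewrite /fps_mul big_ord1 /= mulr0.
by rewrite E HB.
Qed.

Lemma is_bernoulli_uniq B B' : is_bernoulli B -> is_bernoulli B' -> B =1 B'.
Proof.
move=> /is_bernoulliE HB /is_bernoulliE HB' n.
have [m] := ubnP n; elim: m n => // m IHm n lt_nm.
have := HB n; rewrite -(HB' n) !big_ord_recr /= subnn.
have -> : \sum_(k < n) fps_egf B k / ((n - k).+1`!)%:R
        = \sum_(k < n) fps_egf B' k / ((n - k).+1`!)%:R.
  by apply: eq_bigr => k _; rewrite /fps_egf IHm // (leq_trans (ltn_ord k)).
rewrite /fps_egf !(factS 0) fact0 !divr1 => /addrI /mulIf -> //.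
by rewrite invr_eq0 pnatr_eq0 -lt0n fact_gt0.
Qed.

Lemma bernoulli_sig : {B : nat -> rat | is_bernoulli B}.
Proof.
pose next (s : seq rat) : rat :=
  (size s == 0%N)%:R - \sum_(k < size s) s`_k / ((size s - k).+1`!)%:R.
pose pre n := iter n (fun s => rcons s (next s)) [::].
have szp n : size (pre n) = n by elim: n => //= n IHn; rewrite size_rcons IHn.
pose a n := next (pre n).
have preE n k : (k < n)%N -> (pre n)`_k = a k.
  elim: n => // n IHn; rewrite ltnS leq_eqVlt /= nth_rcons szp.
  by case/predU1P => [-> | lt_kn]; rewrite ?ltnn ?eqxx ?lt_kn ?IHn.
exists (fun n => a n * (n`!)%:R); apply/is_bernoulliE => n.
have E k : fps_egf (fun n => a n * (n`!)%:R) k = a k.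
  by rewrite /fps_egf mulfK // pnatr_eq0 -lt0n fact_gt0.
rewrite big_ord_recr /= E subnn (factS 0) fact0 divr1.
rewrite [a n]/(next (pre n)) /next szp addrCA -sumrB big1 ?addr0 // => k _.
by rewrite E preE // subrr.
Qed.

Definition bernoulli : nat -> rat := sval bernoulli_sig.

Lemma bernoulliP : is_bernoulli bernoulli.
Proof. exact: svalP bernoulli_sig. Qed.

Lemma bernoulli0 : bernoulli 0 = 1.
Proof.
have /is_bernoulliE/(_ 0%N) := bernoulliP.
by rewrite big_ord1 /fps_egf fact0 !divr1.
Qed.

Lemma bernoulli1 : bernoulli 1 = - (1 / 2%:R).
Proof.
have /is_bernoulliE/(_ 1%N) := bernoulliP.
rewrite big_ord_recr big_ord1 /fps_egf /= subn0 subnn bernoulli0.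
rewrite (_ : 2`! = 2)%N // fact0 (factS 0) fact0 !divr1 addrC => /eqP.
by rewrite addr_eq0 => /eqP.
Qed.

(* 1 <= N_1 < ... < N_m <= n, with N_k stored at the index k - 1. *)
Definition increasing (m n : nat) (N : {ffun 'I_m -> 'I_n.+1}) : bool :=
  [forall k, (1 <= N k)%N] &&
  [forall k : 'I_m, forall l : 'I_m, (k < l)%N ==> (N k < N l)%N].

(* The multiplicity y_i is stored at the index i - 1; bounding the
   multiplicities by m loses nothing (partition_mult_le). *)
Definition is_partition (m : nat) (y : {ffun 'I_m -> 'I_m.+1}) : bool :=
  (\sum_(i < m) i.+1 * y i)%N == m.

Lemma partition_mult_le (m : nat) (y : 'I_m -> nat) :
  (\sum_(i < m) i.+1 * y i)%N = m -> forall i, (y i <= m)%N.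
Proof.
move=> ym i; rewrite -[X in (_ <= X)%N]ym (bigD1 i) //=.
by rewrite (leq_trans _ (leq_addr _ _)) // leq_pmull.
Qed.

(* Main.v *)
Require Import Defs.
From mathcomp Require Import all_boot all_order all_algebra.
From mathcomp Require Import ring.

Import Order.TTheory GRing.Theory Num.Theory.
Local Open Scope ring_scope.

(** The left-hand side is the elementary symmetric polynomial e_m of the values
    x_N = N ^ p, and the middle term is its expression through the power sums
    p_i = \sum_N x_N ^ i.  That expression comes from the expansion
      \prod_N (1 - x_N X) = exp (- \sum_(i >= 1) p_i X ^ i / i)
                          = \prod_(i >= 1) exp (- p_i X ^ i / i).
    The coefficient of X ^ m is (-1) ^ m e_m on the left; on the right, expanding
    each exponential and choosing the term of rank y_i in the i-th one gives the
    sum over the partitions of m.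

    The expansion is proved with polynomials only: each exponential is truncated
    and the equality is needed up to degree m.  Instead of manipulating
    logarithms, the two products are shown to have the same logarithmic
    derivative - \sum_(i < m) p_(i+1) X ^ i modulo X ^ m.  Logarithmic derivatives
    turn products into sums (log_deriv_prod), and in characteristic 0 they
    determine a polynomial with given constant term up to degree m, by a
    recurrence on coefficients (log_deriv_uniq).

    The second equality replaces each power sum by Faulhaber's formula.  With
    S(x) = \sum_(j <= k) 'C(k+1, j) B_j x ^ (k+1-j), the recurrence of the
    Bernoulli numbers says S(x + 1) - S(x) = (k + 1) x ^ k.  Telescoping this at
    the points -1, ..., -n evaluates the sum of the k-th powers through S(- n), and
    the negative argument is what produces the signs (-1) ^ j. *)

(** * Elementary symmetric sums *)

(** Subsets of cardinality m correspond to increasing sequences of length m: the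
    image of the sequence one way, the ordered enumeration of the set back. *)
Lemma big_increasing_ffun (R : comPzRingType) (m n : nat) (x : 'I_n.+1 -> R) :
  \sum_(A : {set 'I_n.+1} | #|A| == m) \prod_(i in A) x i
  = \sum_(N : {ffun 'I_m -> 'I_n.+1} |
           [forall k : 'I_m, forall l : 'I_m, (k < l)%N ==> (N k < N l)%N])
      \prod_(k < m) x (N k).
Proof.
pose im (N : {ffun 'I_m -> 'I_n.+1}) := [set N k | k : 'I_m].
pose nthA (A : {set 'I_n.+1}) := [ffun k : 'I_m => nth ord0 (enum A) k].
have sortedA d (A : {set 'I_d}) : sorted ltn (map val (enum A)).
  rewrite -[enum _](eq_filter (mem_enum _)).
  rewrite -(eq_filter (mem_map val_inj _)) -filter_map.
  by rewrite (sorted_filter ltn_trans) // unlock val_ord_enum iota_ltn_sorted.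
have nthAK (A : {set 'I_n.+1}) : #|A| == m -> im (nthA A) = A.
  move=> /eqP cA; apply/setP => i; apply/imsetP/idP => [[k _ ->] | iA].
    by rewrite ffunE -mem_enum mem_nth // -cardE cA.
  have lt_im : (index i (enum A) < m)%N by rewrite -cA cardE index_mem mem_enum.
  by exists (Ordinal lt_im) => //; rewrite ffunE nth_index // mem_enum.
rewrite (reindex_onto im nthA) //=.
apply: eq_big => [N | N /andP[/eqP cN /eqP NK]]; last first.
  rewrite big_imset //= => k l _ _ eqN.
  have /imset_injP inj_N : #|im N| == #|'I_m| by rewrite cN card_ord.
  exact: inj_N.
have enumN : [forall k : 'I_m, forall l : 'I_m, (k < l)%N ==> (N k < N l)%N] ->
    enum (im N) = [seq N k | k <- enum 'I_m].
  move=> /forallP incN; apply: (inj_map val_inj).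
  apply: (irr_sorted_eq ltn_trans ltnn) => //.
    rewrite -map_comp sorted_map.
    have := sortedA _ [set: 'I_m].
    rewrite enum_setT -enumT sorted_map; apply: sub_sorted => k l.
    by have /forallP/(_ l)/implyP := incN k.
  move=> y; apply/mapP/mapP=> -[z zP ->]; exists z => //; move: zP.
    by rewrite mem_enum => /imsetP[k _ ->]; apply: map_f; rewrite mem_enum.
  by case/mapP=> k _ ->; rewrite mem_enum; apply: imset_f.
apply/andP/idP=> [[/eqP cN /eqP <-] | incN].
  apply/forallP => k; apply/forallP => l; apply/implyP => lt_kl.
  rewrite !ffunE; have := sortedA _ (im N); set s := enum _ => ss.
  have szs : size s = m by rewrite /s -cardE.
  rewrite -!(nth_map ord0 0%N val) ?szs //.
  by apply: (sorted_ltn_nth ltn_trans) => //; rewrite inE size_map szs.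
have szN : #|im N| = m by rewrite cardE enumN // size_map size_enum_ord.
rewrite szN eqxx; split=> //; apply/eqP/ffunP => k.
by rewrite ffunE enumN // (nth_map k) ?size_enum_ord // nth_ord_enum.
Qed.

Lemma coef_prod_1subX (R : comNzRingType) (I : finType) (x : I -> R) (m : nat) :
  (\prod_i (1 - x i *: 'X))`_m
  = (-1) ^+ m * \sum_(A : {set I} | #|A| == m) \prod_(i in A) x i.
Proof.
under eq_bigr => i _ do rewrite addrC -scaleNr.
rewrite bigA_distr coef_sum mulr_sumr [RHS]big_mkcond; apply: eq_bigr => A _ /=.
rewrite -big_mkcond /= scaler_prod prodr_const coefZ coefXn prodrN.
by rewrite [m == _]eq_sym; case: eqP => [->|]; rewrite ?mulr1 ?mulr0.
Qed.

(** * Truncated logarithmic derivatives *)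

(** The equation F' = u F modulo X ^ m, in which u plays the role of F' / F
    without any division. *)
Definition log_deriv_upto {R : nzRingType} (m : nat) (F u : {poly R}) :=
  exists v, F^`() = u * F + v * 'X^m.

Lemma log_deriv_prod (R : comNzRingType) (m : nat) (I : Type) (s : seq I)
    (F u : I -> {poly R}) :
  (forall i, log_deriv_upto m (F i) (u i)) ->
  log_deriv_upto m (\prod_(i <- s) F i) (\sum_(i <- s) u i).
Proof.
move=> Fu; elim: s => [|i s [v IHs]].
  by exists 0; rewrite !big_nil derivC !mul0r addr0.
have [w Fi] := Fu i; rewrite !big_cons /log_deriv_upto.
exists (w * \prod_(j <- s) F j + F i * v).
by rewrite derivM Fi IHs; ring.
Qed.

(** The coefficient of X ^ j in F' = u F expresses (j + 1) F_(j+1) through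
    F_0, ..., F_j; in characteristic 0 this recurrence determines F. *)
Lemma log_deriv_uniq {R : numDomainType} {m : nat} {u F G : {poly R}} :
    log_deriv_upto m F u -> log_deriv_upto m G u -> F`_0 = G`_0 ->
  forall j, (j <= m)%N -> F`_j = G`_j.
Proof.
move=> [v Fu] [w Gu] FG0; elim/ltn_ind => -[_ //|j IHj] lt_jm.
have dE (H z : {poly R}) : H^`() = u * H + z * 'X^m ->
    H`_j.+1 *+ j.+1 = \sum_(k < j.+1) u`_k * H`_(j - k).
  by move=> Hu; rewrite -coef_deriv Hu coefD coefMXn lt_jm addr0 coefM.
apply/eqP; rewrite -(eqr_pMn2r (ltn0Sn j)) (dE F v Fu) (dE G w Gu).
apply/eqP; apply: eq_bigr => k _; rewrite IHj ?ltnS ?leq_subr //.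
by rewrite (leq_trans (leq_subr _ _)) // ltnW.
Qed.

(** Truncation of the geometric series - a / (1 - a X). *)
Lemma log_deriv_1subX (R : comNzRingType) (m : nat) (a : R) :
  log_deriv_upto m (1 - a *: 'X) (- \sum_(i < m) a ^+ i.+1 *: 'X^i).
Proof.
(* The remainder of the geometric sum, times a. *)
exists (- a ^+ m.+1)%:P.
have -> : \sum_(i < m) a ^+ i.+1 *: 'X^i
   = a%:P * \sum_(i < m) (a *: 'X) ^+ i :> {poly R}.
  rewrite mulr_sumr; apply: eq_bigr => i _.
  by rewrite exprZn mul_polyC scalerA exprS.
have geom := subrX1 (a *: 'X : {poly R}) m.
rewrite derivB derivC derivZ derivX sub0r alg_polyC.
set S := \sum_(i < m) _ in geom *.
have -> : - (a%:P * S) * (1 - a *: 'X) = a%:P * ((a *: 'X) ^+ m - 1).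
  by rewrite geom; ring.
rewrite exprZn -[a ^+ m *: _]mul_polyC polyCN exprS polyCM.
by ring.
Qed.

(** * Truncated exponentials and partitions *)

Definition trunc_exp {R : numFieldType} (M : nat) (q : {poly R}) : {poly R} :=
  \sum_(y < M.+1) (y`!%:R^-1) *: q ^+ y.

Lemma deriv_trunc_exp (R : numFieldType) (M : nat) (q : {poly R}) :
  (trunc_exp M q)^`()
  = q^`() * (trunc_exp M q - (M`!%:R^-1) *: q ^+ M).
Proof.
rewrite /trunc_exp; elim: M => [|M IHM].
  by rewrite big_ord1 fact0 invr1 scale1r expr0 subrr mulr0 derivC.
rewrite big_ord_recr derivD IHM /= addrK derivZ deriv_exp /= mulrBr.
have -> : (M.+1)`!%:R^-1 *: (q^`() * q ^+ M *+ M.+1)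
  = q^`() * ((M`!)%:R^-1 *: q ^+ M).
  rewrite -mulrnAr -[q ^+ M *+ _]scaler_nat -!scalerAr scalerA factS natrM invfM.
  by rewrite mulrAC mulVf ?mul1r // pnatr_eq0.
by rewrite subrK.
Qed.

(** The division by i + 1 makes the argument of the exponential a primitive of
    a X ^ i.  A truncated exponential is its own derivative up to its top term,
    here a multiple of X ^ ((i + 1) m), hence of X ^ m. *)
Lemma log_deriv_trunc_exp (R : numFieldType) (m i : nat) (a : R) :
  log_deriv_upto m (trunc_exp m ((a / i.+1%:R) *: 'X^(i.+1))) (a *: 'X^i).
Proof.
set q := _ *: _; have dq : q^`() = a *: 'X^i.
  by rewrite derivZ derivXn -scaler_nat scalerA mulfVK ?pnatr_eq0.
exists (- (a *: 'X^i * ((m`!%:R^-1 * (a / i.+1%:R) ^+ m) *: 'X^(i * m)))).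
rewrite deriv_trunc_exp dq mulrBr exprZn -exprM mulNr; congr (_ - _).
by rewrite -mulrA -[X in _ = _ * X]scalerAl -exprD scalerA mulSn addnC.
Qed.

(** Truncating at m, the largest possible multiplicity, and using the factors of
    index up to m only, still reaches every partition of m. *)
Lemma coef_prod_trunc_exp (R : numFieldType) (m : nat) (a : 'I_m -> R) :
  (\prod_(i < m) trunc_exp m ((a i / i.+1%:R) *: 'X^(i.+1)))`_m
  = \sum_(y : {ffun 'I_m -> 'I_m.+1} | is_partition y)
      \prod_(i < m) ((a i / i.+1%:R) ^+ y i / (y i)`!%:R).
Proof.
rewrite bigA_distr_bigA coef_sum [RHS]big_mkcond; apply: eq_bigr => y _ /=.
under eq_bigr => i _ do rewrite exprZn scalerA [_^-1 * _]mulrC -exprM.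
rewrite scaler_prod -expr_sum coefZ coefXn eq_sym -/(is_partition y).
by case: ifP; rewrite ?mulr1 ?mulr0.
Qed.

(** * Elementary symmetric sums through power sums *)

(** Both generating polynomials have logarithmic derivative
    - \sum_(i < m) p_(i+1) X ^ i modulo X ^ m and constant term 1, so their
    coefficients of X ^ m agree. *)
Lemma elementary_power_sums (R : numFieldType) (I : finType) (x : I -> R)
    (m : nat) :
  \sum_(A : {set I} | #|A| == m) \prod_(i in A) x i
  = (-1) ^+ m * \sum_(y : {ffun 'I_m -> 'I_m.+1} | is_partition y)
      \prod_(i < m) ((-1) ^+ y i / ((y i)`!%:R * i.+1%:R ^+ y i)
                     * (\sum_t x t ^+ i.+1) ^+ y i).
Proof.
pose P i := \sum_t x t ^+ i.+1.
have ldE : log_deriv_upto m (\prod_t (1 - x t *: 'X))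
                          (\sum_(i < m) - P i *: 'X^i).
  have -> : \sum_(i < m) - P i *: 'X^i
     = \sum_t (- \sum_(i < m) x t ^+ i.+1 *: 'X^i).
    rewrite sumrN exchange_big /= -sumrN; apply: eq_bigr => i _.
    by rewrite scaleNr scaler_suml.
  by apply: log_deriv_prod => t; apply: log_deriv_1subX.
have ldZ : log_deriv_upto m
    (\prod_(i < m) trunc_exp m ((- P i / i.+1%:R) *: 'X^(i.+1)))
    (\sum_(i < m) - P i *: 'X^i).
  by apply: log_deriv_prod => i; apply: log_deriv_trunc_exp.
have E0 : (\prod_t (1 - x t *: 'X))`_0
    = (\prod_(i < m) trunc_exp m ((- P i / i.+1%:R) *: 'X^(i.+1)))`_0.
  rewrite -!horner_coef0 !horner_prod !big1 // => [i _|t _].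
    rewrite /trunc_exp horner_sum big_ord_recl big1 ?addr0 => [|y _].
      by rewrite fact0 invr1 scale1r hornerC.
    by rewrite hornerZ horner_exp hornerZ hornerXn !expr0n /= mulr0 expr0n mulr0.
  by rewrite hornerD hornerN hornerZ hornerX hornerC mulr0 subr0.
have := log_deriv_uniq ldE ldZ E0 m (leqnn m).
rewrite coef_prod_1subX coef_prod_trunc_exp => eqm.
apply: (@mulfI R ((-1) ^+ m)); first by rewrite signr_eq0.
rewrite eqm mulrA -expr2 sqrr_sign mul1r.
apply: eq_bigr => y _; apply: eq_bigr => i _.
by rewrite exprMn exprVn [(- P i) ^+ _]exprNn invfM -/(P i); ring.
Qed.

(** * Faulhaber's formula *)

Lemma bernoulli_binomial_sum (n : nat) :
  \sum_(j < n.+1) 'C(n.+1, j)%:R * bernoulli j = (n == 0%N)%:R.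
Proof.
have /is_bernoulliE/(_ n) E := bernoulliP.
transitivity ((n.+1)`!%:R * (n == 0%N)%:R : rat); last first.
  by case: n {E} => [|n]; rewrite ?mulr0 // mulr1.
rewrite -E mulr_sumr; apply: eq_bigr => j _; rewrite /fps_egf.
have le_jn : (j <= n)%N by rewrite -ltnS.
rewrite -(bin_fact (leqW le_jn)) subSn // 2!natrM.
have f0 k : k`!%:R != 0 :> rat by rewrite pnatr_eq0 -lt0n fact_gt0.
by field; rewrite ?f0.
Qed.

(** The primitive (k + 1) \int_0^x B_k(t) dt of the Bernoulli polynomial B_k, that
    is B_(k+1)(x) - B_(k+1). *)
Definition bernoulli_sum (k : nat) (x : rat) : rat :=
  \sum_(j < k.+1) 'C(k.+1, j)%:R * bernoulli j * x ^+ (k.+1 - j).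

Lemma exprD1_sub (R : comNzRingType) (x : R) (d : nat) :
  (x + 1) ^+ d - x ^+ d = \sum_(l < d) 'C(d, l)%:R * x ^+ l.
Proof.
rewrite [x + 1]addrC exprDn big_ord_recr /= subnn expr0 mul1r binn mulr1n addrK.
by apply: eq_bigr => l _; rewrite expr1n mul1r mulr_natl.
Qed.

Lemma mul_bin_fact (n i j : nat) : (i + j <= n)%N ->
  ('C(n, i) * 'C(n - i, j) * (i`! * j`! * (n - (i + j))`!) = n`!)%N.
Proof.
move=> le_ijn; have le_in := leq_trans (leq_addr j i) le_ijn.
rewrite -(bin_fact le_in) -(@bin_fact (n - i) j) ?leq_subRL // subnDA.
by rewrite !mulnA; ring.
Qed.

(** Both sides count the pairs of disjoint subsets, of sizes i and j, of a set of
    size n. *)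
Lemma mul_bin_subC {n i j : nat} : (i + j <= n)%N ->
  ('C(n, i) * 'C(n - i, j) = 'C(n, j) * 'C(n - j, i))%N.
Proof.
move=> le_ijn; have le_jin : (j + i <= n)%N by rewrite addnC.
apply/eqP; rewrite -(@eqn_pmul2r (i`! * j`! * (n - (i + j))`!)).
  by rewrite mul_bin_fact // [(i`! * _)%N]mulnC addnC mul_bin_fact.
by rewrite !muln_gt0 !fact_gt0.
Qed.

(** After the binomial expansion, the coefficient of x ^ l is a multiple of
    \sum_(j <= k - l) 'C(k+1-l, j) B_j, which vanishes unless l = k. *)
Lemma bernoulli_sumD1 (k : nat) (x : rat) :
  bernoulli_sum k (x + 1) - bernoulli_sum k x = k.+1%:R * x ^+ k.
Proof.
transitivity (\sum_(j < k.+1) \sum_(l < k.+1 | (j + l < k.+1)%N)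
   'C(k.+1, l)%:R * x ^+ l * ('C(k.+1 - l, j)%:R * bernoulli j)).
  rewrite -sumrB; apply: eq_bigr => j _.
  rewrite -mulrBr exprD1_sub mulr_sumr.
  have le_jk := ltnW (ltn_ord j).
  rewrite (big_ord_widen _ (fun l => 'C(k.+1, j)%:R * bernoulli j *
     ('C(k.+1 - j, l)%:R * x ^+ l)) (leq_subr j k.+1)).
  apply: eq_big => l; first by rewrite ltn_subRL.
  rewrite ltn_subRL => lt_jl.
  have := mul_bin_subC (ltnW lt_jl).
  move=> /(congr1 (GRing.natmul (1 : rat))); rewrite !natrM => E.
  transitivity ('C(k.+1, j)%:R * 'C(k.+1 - j, l)%:R * (bernoulli j * x ^+ l)).
    by ring.
  by rewrite E; ring.
rewrite (exchange_big_dep xpredT) //=.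
transitivity (\sum_(l < k.+1) 'C(k.+1, l)%:R * x ^+ l * ((k - l)%N == 0%N)%:R).
  apply: eq_bigr => l _; rewrite -bernoulli_binomial_sum mulr_sumr.
  have le_lk : (l <= k)%N by rewrite -ltnS.
  rewrite -subSn // (big_ord_widen _ (fun j => 'C(k.+1, l)%:R * x ^+ l *
     ('C(k.+1 - l, j)%:R * bernoulli j)) (leq_subr l k.+1)).
  by apply: eq_bigl => j; rewrite ltn_subRL addnC.
rewrite big_ord_recr /= subnn eqxx mulr1 binSn big1 ?add0r // => l _.
by rewrite subn_eq0 leqNgt ltn_ord mulr0.
Qed.

(** Stepping from - (n + 1) to - n with bernoulli_sumD1 contributes
    (k + 1) (- (n + 1)) ^ k, whose sign the factor (-1) ^ (k + 1) absorbs. *)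
Lemma sum_powers_bernoulli_sum (k n : nat) :
  k.+1%:R * \sum_(1 <= N < n.+1) N%:R ^+ k
  = (-1) ^+ k.+1 * bernoulli_sum k (- n%:R).
Proof.
elim: n => [|n IHn].
  rewrite big_geq // mulr0 /bernoulli_sum big1 ?mulr0 // => j _.
  by rewrite oppr0 expr0n subn_eq0 leqNgt ltn_ord mulr0.
rewrite big_nat_recr //= mulrDr IHn.
have := bernoulli_sumD1 k (- n.+1%:R).
have -> : - n.+1%:R + 1 = - n%:R :> rat by rewrite -natr1; ring.
move/(canRL (subrK _)) ->.
rewrite mulrDr addrAC [X in X + _](_ : _ = 0) ?add0r //.
rewrite [(- n.+1%:R) ^+ k]exprNn exprS.
have : (-1) ^+ k * (-1) ^+ k = 1 :> rat by rewrite -expr2 sqrr_sign.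
move: ((-1) ^+ k) => s ss.
transitivity (k.+1%:R * n.+1%:R ^+ k * (1 - s * s)); first by ring.
by rewrite ss subrr mulr0.
Qed.

Lemma faulhaber (k n : nat) : (0 < n)%N ->
  \sum_(1 <= N < n.+1) N%:R ^+ k
  = n%:R ^+ k.+1 / k.+1%:R
     * \sum_(0 <= j < k.+1)
         (-1) ^+ j * 'C(k.+1, j)%:R * (bernoulli j / n%:R ^+ j) :> rat.
Proof.
move=> n_gt0; have k0 : k.+1%:R != 0 :> rat by rewrite pnatr_eq0.
have n0 : n%:R != 0 :> rat by rewrite pnatr_eq0 -lt0n.
apply: (mulfI k0); rewrite sum_powers_bernoulli_sum mulrA mulrCA mulfV // mulr1.
rewrite big_mkord !mulr_sumr; apply: eq_bigr => j _.
have le_jk := ltnW (ltn_ord j).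
have split_exp (a : rat) : a ^+ k.+1 = a ^+ (k.+1 - j) * a ^+ j.
  by rewrite -exprD subnK.
rewrite [(- n%:R) ^+ _]exprNn !split_exp.
have : (-1) ^+ (k.+1 - j) * (-1) ^+ (k.+1 - j) = 1 :> rat.
  by rewrite -expr2 sqrr_sign.
move: ((-1) ^+ (k.+1 - j)) => s ss.
have nj0 : n%:R ^+ j != 0 :> rat by rewrite expf_neq0.
transitivity (s * s * (-1) ^+ j * 'C(k.+1, j)%:R * bernoulli j
              * n%:R ^+ (k.+1 - j)).
  by ring.
by rewrite ss; field.
Qed.

Theorem theorem5p1 (m n p : nat) (hmn : (m <= n)%N) :
  \sum_(N : {ffun 'I_m -> 'I_n.+1} | increasing N)
      \prod_(k < m) ((N k)%:R ^+ p : rat)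
  = (-1) ^+ m * \sum_(y : {ffun 'I_m -> 'I_m.+1} | is_partition y)
      \prod_(i < m)
        ((-1) ^+ y i / ((y i)`!%:R * i.+1%:R ^+ y i)
          * (\sum_(1 <= N < n.+1) N%:R ^+ (i.+1 * p)) ^+ y i)
  /\
  (-1) ^+ m * \sum_(y : {ffun 'I_m -> 'I_m.+1} | is_partition y)
      \prod_(i < m)
        ((-1) ^+ y i / ((y i)`!%:R * i.+1%:R ^+ y i)
          * (\sum_(1 <= N < n.+1) N%:R ^+ (i.+1 * p)) ^+ y i)
  = (-1) ^+ m * \sum_(y : {ffun 'I_m -> 'I_m.+1} | is_partition y)
      \prod_(i < m)
        ((-1) ^+ y i / ((y i)`!%:R * i.+1%:R ^+ y i)
          * (n%:R ^+ (i.+1 * p).+1 / (i.+1 * p).+1%:R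
             * \sum_(0 <= j < (i.+1 * p).+1)
                 (-1) ^+ j * 'C((i.+1 * p).+1, j)%:R
                   * (bernoulli j / n%:R ^+ j)) ^+ y i)
  :> rat.
Proof.
split; last first.
  congr (_ * _); apply: eq_bigr => y _; apply: eq_bigr => i _.
  (* A factor of index i : 'I_m exists only if 0 < m, which forces 0 < n. *)
  by rewrite faulhaber // (leq_trans _ hmn) // (leq_ltn_trans _ (ltn_ord i)).
(* The index 0 of 'I_n.+1 gets weight 0, so that sequences starting at 0 do not
   contribute, even when p = 0. *)
pose x (N : 'I_n.+1) : rat := if (1 <= N)%N then N%:R ^+ p else 0.
transitivity (\sum_(A : {set 'I_n.+1} | #|A| == m) \prod_(N in A) x N).
  rewrite big_increasing_ffun /increasing.
  rewrite [RHS](bigID (fun N : {ffun 'I_m -> 'I_n.+1} =>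
    [forall k, (1 <= N k)%N])) /=.
  rewrite [X in _ + X]big1 ?addr0 => [|N /andP[_]]; last first.
    rewrite negb_forall => /existsP[k N0].
    by rewrite (bigD1 k) //= /x (negPf N0) mul0r.
  apply: eq_big => N; first by rewrite andbC.
  by case/andP=> /forallP N1 _; apply: eq_bigr => k _; rewrite /x N1.
rewrite elementary_power_sums; congr (_ * _).
apply: eq_bigr => y _; apply: eq_bigr => i _; congr (_ * _ ^+ _).
rewrite big_ord_recl /= /x /= expr0n add0r.
rewrite big_add1 /= big_mkord; apply: eq_bigr => N _.
by rewrite /= -exprM mulnC.
Qed.
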